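(* Let $n\neq 1$ be a square-free integer and let $K=\mathbb{Q}(\sqrt{n})$ with ring of integers $\mathcal{O}_K$. Let $a_1,a_2$ be coprime positive integers such that $a_1a_2+n=x^2$ for some $x\in\mathbb{Z}$. For $i=1,2$ let $\mathfrak{a}_i=\langle a_i,\,x+\sqrt{n}\rangle$ be the ideal of $\mathcal{O}_K$ generated by $a_i$ and $x+\sqrt{n}$. Then $\mathcal{N}(\mathfrak{a}_i)=a_i$ for $i=1,2$, and $\mathfrak{a}_1\mathfrak{a}_2$ is a principal ideal.
   Context: $\mathcal{N}(\cdot)$ denotes the absolute norm of an ideal of $\mathcal{O}_K$ (equivalently the norm map from $K$ to $\mathbb{Q}$ on principal ideals). *)

(* Defs.v *)
From HB Require Import structures.
From mathcomp Require Import all_boot all_order all_algebra all_field.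
From mathcomp Require Import finmap all_classical.

Set Implicit Arguments.
Unset Strict Implicit.
Unset Printing Implicit Defensive.

Import Order.TTheory GRing.Theory Num.Theory.

Local Open Scope classical_set_scope.
Local Open Scope ring_scope.

(* n = 0 is not squarefree: take d = 0. *)
Definition squarefreez (n : int) : Prop :=
  forall d : int, (d ^+ 2 %| n)%Z -> `|d| = 1.

Definition algint (K : fieldExtType rat) : {pred K} :=
  [pred z | `[< integralOver (intr : int -> K) z >]].
Arguments algint K : clear implicits.

Lemma algintP (K : fieldExtType rat) (z : K) :
  reflect (integralOver (intr : int -> K) z) (z \in algint K).
Proof. exact: asboolP. Qed.

Lemma algint_subring_closed (K : fieldExtType rat) : subring_closed (algint K).
Proof.
split=> [|u v /algintP iu /algintP iv|u v /algintP iu /algintP iv].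
- by apply/algintP; apply: integral1.
- by apply/algintP; apply: integral_sub.
- by apply/algintP; apply: integral_mul.
Qed.

HB.instance Definition _ (K : fieldExtType rat) :=
  GRing.isSubringClosed.Build K (algint K) (algint_subring_closed K).

Record ringOfIntegers (K : fieldExtType rat) := RingOfIntegers {
  algint_val :> K;
  algint_valP : algint_val \in algint K
}.

HB.instance Definition _ (K : fieldExtType rat) :=
  [isSub for @algint_val K].
HB.instance Definition _ (K : fieldExtType rat) :=
  [Choice of ringOfIntegers K by <:].
HB.instance Definition _ (K : fieldExtType rat) :=
  [SubChoice_isSubComNzRing of ringOfIntegers K by <:].

Lemma sqrt_algint (K : fieldExtType rat) (n : int) (s : K) :
  s ^+ 2 = n%:~R -> s \in algint K.
Proof.
move=> hs; apply/algintP; exists ('X^2 - n%:P); first exact: monicXnsubC.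
by rewrite rmorphB /= map_polyXn map_polyC /root !hornerE hs subrr.
Qed.

Definition sqrt_int (K : fieldExtType rat) (n : int) (s : K)
    (hs : s ^+ 2 = n%:~R) : ringOfIntegers K :=
  RingOfIntegers (sqrt_algint hs).

Section Ideals.
Variable R : comNzRingType.
Implicit Types I J : set R.

(* idealr_closed from ring_quotient excludes the unit ideal, which is an
   ideal here. *)
Definition is_ideal I : Prop :=
  [/\ I 0, (forall u v, I u -> I v -> I (u + v))
    & (forall r u, I u -> I (r * u))].

Definition ideal_span (G : set R) : set R := smallest is_ideal G.

Definition ideal_mul I J : set R :=
  ideal_span [set z | exists u v, [/\ I u, J v & z = u * v]].

Definition principal_ideal I : Prop := exists g, I = ideal_span [set g].

Definition ideal_coset I (r : R) : set R := [set z | I (z - r)].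

(* Cardinality of R / I; the value is 0 when the quotient is infinite. *)
Definition absolute_norm I : nat := #|` fset_set (range (ideal_coset I)) |%fset.

End Ideals.

(* For every integer n there is a number field generated over the rationals by
   a square root of n. *)
Lemma quadratic_field_exists (n : int) :
  exists (K : fieldExtType rat) (s : K),
    s ^+ 2 = n%:~R /\ <<1; s>>%VS = {:K}%VS.
Proof.
have [K [f [[|s [|//]] //= [hs] gens]]] :=
  num_field_exists [:: sqrtC (n%:~R : algC)].
exists K, s; split; last by rewrite -adjoin_seq1.
by apply: (fmorph_inj f); rewrite rmorphXn /= hs sqrtCK rmorph_int.
Qed.

(* Main.v *)
Require Import Defs.
From HB Require Import structures.
From mathcomp Require Import all_boot all_order all_algebra all_field.
From mathcomp Require Import finmap all_classical.
From mathcomp Require Import ring zify.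

Set Implicit Arguments.
Unset Strict Implicit.
Unset Printing Implicit Defensive.

Import Order.TTheory GRing.Theory Num.Theory.

Local Open Scope classical_set_scope.
Local Open Scope ring_scope.

(** If w is a Z-basis complement of 1 in O_K and b divides the norm of c + w,
    then d * b and d * (c + w) span over Z an ideal of index d ^ 2 * b. Each
    ideal <a_i, x + sqrt n> has this shape: when O_K = Z[sqrt n], with d = 1,
    b = a_i and c = x; when w = (1 + sqrt n) / 2, with d = 1 if a_i is odd,
    and with d = 2, b = a_i / 4 if a_i is even, the other a_j being then odd.
    The product is <x + sqrt n>, since a_1 a_2 is the norm of x + sqrt n and
    a_1, a_2 are comaximal. *)

(** * Ideals with one or two generators, and their products *)

Section Spans.
Variable R : comNzRingType.
Implicit Types (a b g : R) (G : set R).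

Lemma ideal_span_is_ideal G : is_ideal (ideal_span G).
Proof.
split=> [I [[]]//|u v Gu Gv I GI|r u Gu I GI].
- by case: (GI) => -[_ addI _] _; apply: addI; [apply: Gu|apply: Gv].
- by case: (GI) => -[_ _ mulI] _; apply: mulI; apply: Gu.
Qed.

Lemma ideal_span1E g : ideal_span [set g] = [set z | exists r, z = r * g].
Proof.
apply/seteqP; split.
- apply: smallest_sub => [|_ ->]; last by exists 1; rewrite mul1r.
  split=> /= [|_ _ [r ->] [r' ->]|r _ [r' ->]].
  + by exists 0; rewrite mul0r.
  + by exists (r + r'); rewrite mulrDl.
  + by exists (r * r'); rewrite mulrA.
- move=> _ [r ->]; have [_ _ mulI] := ideal_span_is_ideal [set g].
  by apply: mulI; apply: sub_gen_smallest.
Qed.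

Lemma ideal_span2E a b :
  ideal_span [set a; b] = [set z | exists r r', z = r * a + r' * b].
Proof.
apply/seteqP; split.
- apply: smallest_sub => [|_ [->|->]].
  + split=> /= [|_ _ [r [r' ->]] [q [q' ->]]|r _ [q [q' ->]]].
    * by exists 0, 0; ring.
    * by exists (r + q), (r' + q'); ring.
    * by exists (r * q), (r * q'); ring.
  + by exists 1, 0; ring.
  + by exists 0, 1; ring.
- move=> _ [r [r' ->]]; have [_ addI mulI] := ideal_span_is_ideal [set a; b].
  by apply: addI; apply: mulI; apply: sub_gen_smallest; [left|right].
Qed.

Lemma ideal_span2_eq a b a' b' :
    ideal_span [set a'; b'] a -> ideal_span [set a'; b'] b ->
    ideal_span [set a; b] a' -> ideal_span [set a; b] b' ->
  ideal_span [set a; b] = ideal_span [set a'; b'].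
Proof.
move=> ha hb ha' hb'; apply/seteqP.
by split; apply: smallest_sub => [|_ [->|->]] //; apply: ideal_span_is_ideal.
Qed.

(* As a and b are comaximal, g = u * a * g + v * g * b. *)
Lemma ideal_mul_comaximal (u v a b g h : R) :
    u * a + v * b = 1 -> a * b = g * h ->
  ideal_mul (ideal_span [set a; g]) (ideal_span [set b; g])
    = ideal_span [set g].
Proof.
move=> uv1 abE; apply/seteqP; split.
- apply: smallest_sub; first exact: ideal_span_is_ideal.
  rewrite !ideal_span2E ideal_span1E.
  move=> _ [_ [_ [[r [r' ->]] [q [q' ->]] ->]]] /=.
  exists (r * q * h + r * q' * a + r' * q * b + r' * q' * g).
  transitivity (r * q * (a * b) + (r * q' * a + r' * q * b + r' * q' * g) * g).
    by ring.
  by rewrite abE; ring.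
- apply: smallest_sub; first exact: ideal_span_is_ideal.
  move=> _ ->; rewrite /ideal_mul; set M := [set z | _].
  have [_ addI mulI] := ideal_span_is_ideal M.
  have -> : g = u * (a * g) + v * (g * b).
    by transitivity ((u * a + v * b) * g); [rewrite uv1 mul1r|ring].
  apply: addI; apply: mulI; apply: sub_gen_smallest.
  + by exists a, g; split=> //; apply: sub_gen_smallest; [left|right].
  + by exists g, b; split=> //; apply: sub_gen_smallest; [right|left].
Qed.

End Spans.

Lemma coprimez_even_odd (k a : int) :
  coprimez (2 * k) a -> exists e : int, a = 2 * e + 1.
Proof.
move=> /coprimezP[[u v] /= uv]; exists (a %/ 2)%Z; set e := (a %/ 2)%Z.
by have [aE|//] : a = 2 * e \/ a = 2 * e + 1; [lia | rewrite aE in uv; nia].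
Qed.

(** * Index of ideals in a ring with Z-basis [1, w] *)

Section QuadraticOrder.
Variables (R : comNzRingType) (w : R) (t m : int).
Hypothesis w_gen : forall z : R, exists p q : int, z = p%:~R + q%:~R * w.
Hypothesis w_free :
  forall p q : int, p%:~R + q%:~R * w = 0 -> p = 0 /\ q = 0.
Hypothesis w_sqr : w ^+ 2 = t%:~R * w + m%:~R.

(* The congruence on c says that b divides the norm of c + w; it makes the
   lattice spanned by d * b and d * (c + w) an ideal. *)
Lemma ideal_span_lattice (d b c : int) : (b %| c ^+ 2 + t * c - m)%Z ->
  ideal_span [set (d * b)%:~R; d%:~R * (c%:~R + w)] =
  [set z | exists i j : int,
    z = (d * (b * i + c * j))%:~R + (d * j)%:~R * w].
Proof.
move=> /dvdzP[e eE]; apply/seteqP; split; last first.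
  move=> _ [i [j ->]]; rewrite ideal_span2E; exists i%:~R, j%:~R.
  by ring.
apply: smallest_sub => [|_ [->|->]]; last 2 first.
- by exists 1, 0; ring.
- by exists 0, 1; ring.
split=> /= [|_ _ [i [j ->]] [i' [j' ->]]|r _ [i [j ->]]].
- by exists 0, 0; ring.
- by exists (i + i'), (j + j'); ring.
have [p [q ->]] := w_gen r.
(* Coordinates of the product once [w ^+ 2] is replaced by [t * w + m]; the norm of [c + w] is
   [e * b], and [m] is eliminated through it. *)
exists (p * i - q * (i * c + j * e)), (p * j + q * (b * i + c * j + t * j)).
have mE : m = c ^+ 2 + t * c - e * b by rewrite -eE; ring.
transitivity ((p * (d * (b * i + c * j)))%:~R
  + (q * (d * (b * i + c * j)) + p * (d * j))%:~R * w
  + (q * (d * j))%:~R * w ^+ 2 :> R); first by ring.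
by rewrite w_sqr mE; ring.
Qed.

(** In the basis [1, w] the two lattice generators are triangular with diagonal [d * b] and [d], so
    the index is the product of these. *)
Lemma absolute_norm_lattice (d b c : int) : 0 < d -> 0 < b ->
    (b %| c ^+ 2 + t * c - m)%Z ->
  (absolute_norm (ideal_span [set (d * b)%:~R; d%:~R * (c%:~R + w)]))%:Z
    = d * d * b.
Proof.
move=> d0 b0 bc; rewrite ideal_span_lattice //; set I := [set z | _].
case: d d0 @I => // d d0 I; case: b b0 bc @I => // b b0 bc I.
have I0 : I 0 by exists 0, 0; ring.
have IB u v : I u -> I v -> I (u - v).
  by move=> [i [j ->]] [i' [j' ->]]; exists (i - i'), (j - j'); ring.
(* The representatives are i + j * w with i < d * b and j < d. *)
pose rep k : R := (k %/ d)%N%:Z%:~R + (k %% d)%N%:Z%:~R * w.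
have cosetP u v : (ideal_coset I u = ideal_coset I v) <-> I (u - v).
  split=> [uv|Iuv].
    have : ideal_coset I u u by rewrite /ideal_coset /= subrr.
    by rewrite uv.
  apply/seteqP; split=> z /= Iz; rewrite /ideal_coset /=.
    have -> : z - v = (z - u) - (0 - (u - v)) by ring.
    by apply: (IB _ _ Iz (IB _ _ I0 Iuv)).
  have -> : z - u = (z - v) - (u - v) by ring.
  exact: IB.
rewrite /absolute_norm.
have -> : range (ideal_coset I) = (ideal_coset I \o rep) @` `I_(d * b * d).
  apply/seteqP; split=> [_ [z _ <-]|_ [k _ <-]]; last by exists (rep k).
  have [p [q ->]] := w_gen z.
  (* The coordinate along [w] is reduced first, by [q1] copies of [d * (c + w)]; this shifts the
     other coordinate to [p'], which is then reduced modulo [d * b]. *)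
  pose q1 := (q %/ d%:Z)%Z; pose q0 := (q %% d%:Z)%Z.
  pose p' := p - c * (d%:Z * q1).
  pose p1 := (p' %/ (d * b)%N%:Z)%Z; pose p0 := (p' %% (d * b)%N%:Z)%Z.
  have qE : q = q1 * d%:Z + q0 := divz_eq _ _.
  have pE : p' = p1 * (d * b)%N%:Z + p0 := divz_eq _ _.
  have q0ge : 0 <= q0 by apply: modz_ge0; lia.
  have p0ge : 0 <= p0 by apply: modz_ge0; nia.
  have q0lt : q0 < d by apply: ltz_pmod.
  have p0lt : p0 < (d * b)%N by apply: ltz_pmod; nia.
  have [q0' q0E] : exists k : nat, q0 = k by exists `|q0|%N; lia.
  have [p0' p0E] : exists k : nat, p0 = k by exists `|p0|%N; lia.
  exists (p0' * d + q0')%N; first by rewrite /=; nia.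
  apply/cosetP; rewrite /rep divnMDl ?divn_small ?addn0 ?modnMDl ?modn_small;
    try lia.
  exists (- p1), (- q1); rewrite -p0E -q0E.
  have -> : p0 = p' - p1 * (d * b)%N%:Z by rewrite pE; ring.
  by rewrite {1}qE /p' PoszM; ring.
have -> : (d%:Z * d%:Z * b%:Z) = (d * b * d)%N by lia.
congr (Posz _); apply: card_fset_set; apply: inj_card_eq => k l.
rewrite !inE /= => kd ld /cosetP[i [j]].
set k1 := (k %/ d)%N; set k0 := (k %% d)%N.
set l1 := (l %/ d)%N; set l0 := (l %% d)%N.
rewrite /rep -/k1 -/k0 -/l1 -/l0 => E.
have k0d : (k0 < d)%N by rewrite ltn_mod.
have l0d : (l0 < d)%N by rewrite ltn_mod.
have kE : k = (k1 * d + k0)%N := divn_eq _ _.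
have lE : l = (l1 * d + l0)%N := divn_eq _ _.
(* Equal cosets give one equation per coordinate. Remainders below [d] force [j = 0]; then quotients
   below [d * b] force [i = 0]. *)
have [/eqP E1 /eqP E2] : (k1%:Z - l1%:Z - d%:Z * (b%:Z * i + c * j)) = 0 /\
    (k0%:Z - l0%:Z - d%:Z * j) = 0.
  apply: w_free; move/eqP: E; rewrite -subr_eq0 => /eqP <-; ring.
have j0 : j = 0 by nia.
have k1b : (k1 < d * b)%N by rewrite ltn_divLR.
have l1b : (l1 < d * b)%N by rewrite ltn_divLR.
have i0 : i = 0.
  have E1' : k1%:Z - l1%:Z = (d * b)%N%:Z * i.
    by move: E1; rewrite j0 mulr0 addr0 subr_eq0 => /eqP ->; lia.
  by nia.
by rewrite kE lE; congr (_ * _ + _)%N; nia.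
Qed.

Lemma absolute_norm_span_sqrt (a x : int) : t = 0 -> 0 < a ->
    (a %| x ^+ 2 - m)%Z ->
  (absolute_norm (ideal_span [set a%:~R; x%:~R + w]))%:Z = a.
Proof.
move=> t0 a0 ax.
have := absolute_norm_lattice (d := 1) (c := x) isT a0.
by rewrite !mul1r t0 mul0r addr0; apply.
Qed.

(** As [k + 1] is an inverse of 2 modulo [2 * k + 1], the element [(k + 1) * (x - 1) + w] stands for
    half of [x + (2 * w - 1)] and generates the same ideal together with [2 * k + 1]. *)
Lemma absolute_norm_span_half_odd (k x : int) : t = 1 -> 0 < 2 * k + 1 ->
    (2 * k + 1 %| x ^+ 2 - (4 * m + 1))%Z ->
  (absolute_norm (ideal_span [set (2 * k + 1)%:~R; x%:~R + (2 * w - 1)]))%:Z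
    = 2 * k + 1.
Proof.
move=> t1 a0 /dvdzP[e eE].
have := absolute_norm_lattice (d := 1)
  (c := (k + 1) * (x - 1)) isT a0.
rewrite !mul1r t1 mul1r => E.
rewrite -[RHS]E; last first.
  have cop : coprimez (2 * k + 1) 4.
    by apply/coprimezP; exists (1 - 2 * k, k ^+ 2) => /=; ring.
  (* For the chosen [c], [2 * c + 1 = x + (2 * k + 1) * (x - 1)], and 4 times the norm of [c + w] is
     [(2 * c + 1) ^ 2 - (4 * m + 1)]. *)
  rewrite -(Gauss_dvdzr _ cop); apply/dvdzP.
  exists (e + (2 * k + 1) * (x - 1) ^+ 2 + 2 * x * (x - 1)).
  transitivity (x ^+ 2 - (4 * m + 1)
    + ((2 * k + 1) * (x - 1) ^+ 2 + 2 * x * (x - 1)) * (2 * k + 1)).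
    by ring.
  by rewrite eE; ring.
congr (Posz (absolute_norm _)).
apply: ideal_span2_eq; rewrite ideal_span2E.
- by exists 1, 0; ring.
- by exists (- (x%:~R - 1)), 2; ring.
- by exists 1, 0; ring.
- by exists (- w), (k%:~R + 1); ring.
Qed.

(** The generator [4 * b] may be replaced by [2 * b], which gives a lattice with [d = 2]. The
    equation for [c] says that [c + w] has norm [b * a2]; its conjugate is [c + 1 - w]. *)
Lemma absolute_norm_span_half_even (b c a2 : int) : t = 1 -> 0 < b ->
    coprimez (4 * b) a2 -> c ^+ 2 + c - m = b * a2 ->
  (absolute_norm (ideal_span [set (4 * b)%:~R; 2 * (c%:~R + w)]))%:Z
    = 4 * b.
Proof.
move=> t1 b0 cop cE.
have := absolute_norm_lattice (d := 2) (c := c) isT b0.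
rewrite t1 mul1r cE => /(_ (dvdz_mulr _ (dvdzz _))) E.
rewrite -[in RHS]E; congr (Posz (absolute_norm _)).
have [e eE] : exists e : int, a2 = 2 * e + 1.
  apply: (@coprimez_even_odd (2 * b)).
  by have <- : 4 * b = 2 * (2 * b) by ring.
apply: ideal_span2_eq; rewrite ideal_span2E.
- by exists 2, 0; ring.
- by exists 0, 1; ring.
(* 2 * b is reached from 4 * b and 2 * N(c + w) = 2 * b * a2, as a2 is odd. *)
- exists (- e%:~R), (c%:~R + 1 - w).
  transitivity ((2 * (b * a2) - e * (4 * b))%:~R : R).
    by rewrite eE; ring.
  rewrite -cE.
  transitivity (- e%:~R * (4 * b)%:~R + 2 * (c ^+ 2 + c)%:~R + 2 * w
    - 2 * w ^+ 2); last by ring.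
  by rewrite w_sqr t1; ring.
- by exists 0, 1; ring.
Qed.

End QuadraticOrder.

(** * Rational numbers that must be integers *)

Lemma squarefree_mul_sqr_int (n k : int) (q : rat) :
  squarefreez n -> n%:~R * q ^+ 2 = k%:~R -> exists v : int, q = v%:~R.
Proof.
move=> hn kE; have E : n * numq q ^+ 2 = k * denq q ^+ 2.
  apply: (@intr_inj rat).
  by rewrite !intrM /= numqE -kE; ring.
(* The squared denominator is coprime to the squared numerator, so it divides [n], and the
   denominator is 1. *)
have : (denq q ^+ 2 %| n)%Z.
  have cop : coprimez (denq q ^+ 2) (numq q ^+ 2).
    rewrite coprimezE !abszX coprimeXl // coprimeXr // coprime_sym.
    exact: coprime_num_den.
  by rewrite -(Gauss_dvdzl _ cop) E dvdz_mull.
move/hn; rewrite ger0_norm ?denq_ge0 // => d1.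
by exists (numq q); rewrite -{1}[q]divq_num_den d1 divr1.
Qed.

Lemma map_poly_intr (R S : nzRingType) (f : {rmorphism R -> S})
    (P : {poly int}) :
  map_poly intr P = map_poly f (map_poly intr P) :> {poly S}.
Proof.
rewrite -map_poly_comp_id0 ?rmorph0 //.
by apply: eq_map_poly => i /=; rewrite rmorph_int.
Qed.

(** The monic relation is pulled back to the rationals and moved to [algC], where rational algebraic
    integers are integers. *)
Lemma integral_rat_int (K : fieldType) (f : {rmorphism rat -> K}) (r : rat) :
  integralOver (intr : int -> K) (f r) -> exists k : int, r = k%:~R.
Proof.
move=> [P monP rootP].
move: rootP; rewrite (map_poly_intr f) fmorph_root.
rewrite -(fmorph_root (ratr : {rmorphism rat -> algC})) => rootP.
have /Cint_rat_Aint : ratr r \in Crat by exact: Crat_rat.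
have /[swap]/[apply] : ratr r \in Aint.
  apply: root_monic_Aint rootP _ _; first by rewrite map_monic monic_map.
  by apply/polyOverP=> i; rewrite !coef_map /= rmorph_int.
move=> /intrP[k /eqP]; rewrite -(ratr_int algC) (inj_eq (fmorph_inj _)).
by move=> /eqP->; exists k.
Qed.

(** * Integral elements of a quadratic field *)

Section QuadraticField.
Variables (K : fieldType) (f : {rmorphism rat -> K}) (n : int) (s : K).
Hypothesis hs : s ^+ 2 = n%:~R.

(* A root p + q * s of a rational polynomial has a conjugate root p - q * s,
   because 1 and s are independent. *)
Lemma horner_quadratic_conj (P : {poly rat}) (p q : rat) :
  exists A B : rat, (map_poly f P).[f p + f q * s] = f A + f B * s /\
                    (map_poly f P).[f p - f q * s] = f A - f B * s.
Proof.
elim/poly_ind: P => [|P c [A [B [IH IH']]]].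
  by exists 0, 0; rewrite !rmorph0 !horner0; split; ring.
exists (A * p + n%:~R * B * q + c), (A * q + B * p).
rewrite rmorphD rmorphM /= map_polyX map_polyC !hornerE IH IH'.
rewrite !(rmorphD, rmorphM) /= rmorph_int -hs; split; ring.
Qed.

Hypotheses (hn : squarefreez n) (hn1 : n <> 1).

(** A relation with [B] nonzero makes [n] times the square of [B / A] equal to 1; as [n] is
    square-free, [B / A] is an integer, whence [n = 1]. *)
Lemma quadratic_free (A B : rat) : f A + f B * s = 0 -> A = 0 /\ B = 0.
Proof.
move=> E; case: (eqVneq B 0) => [B0|B0].
  move: E; rewrite B0 rmorph0 mul0r addr0 => /eqP.
  by rewrite fmorph_eq0 => /eqP.
have E2 : A ^+ 2 = n%:~R * B ^+ 2.
  apply: (fmorph_inj f); rewrite rmorphXn rmorphM rmorphXn /= rmorph_int -hs.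
  by rewrite -exprMn -[f A](addrK (f B * s)) E sub0r sqrrN mulrC.
have n0 : n != 0.
  by apply/eqP => n0; have := @hn 0; rewrite n0 dvdz0 normr0 => /(_ isT).
have A0 : A != 0.
  apply: contra_neq B0 => A0; move/eqP: E2; rewrite A0 expr0n eq_sym.
  by rewrite mulf_eq0 intr_eq0 (negPf n0) expf_eq0 => /eqP.
have Ev : n%:~R * (B / A) ^+ 2 = 1%:~R.
  by rewrite expr_div_n mulrA -E2 mulfV // expf_neq0.
have [v vE] := squarefree_mul_sqr_int hn Ev.
have : n * v ^+ 2 = 1.
  by apply: (@intr_inj rat); rewrite intrM rmorphXn /= -vE.
have := sqr_ge0 v; move: (v ^+ 2) => y y0 E1; case: hn1.
have y1 : y != 0 by apply: contra_eq_neq E1 => ->; rewrite mulr0.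
by case: (ltrgtP n 1) => // n1; nia.
Qed.

(** The trace [2 * p] and the norm are rational and integral, hence integers [u] and [N]. Then
    [n * (2 * q) ^ 2 = u ^ 2 - 4 * N] is an integer, and so is [2 * q], as [n] is square-free. *)
Lemma integral_quadratic (p q : rat) :
    integralOver (intr : int -> K) (f p + f q * s) ->
  exists u v N : int,
    [/\ p = u%:~R / 2, q = v%:~R / 2 & u ^+ 2 - n * v ^+ 2 = 4 * N].
Proof.
move=> iz; have iz' : integralOver (intr : int -> K) (f p - f q * s).
  have [P monP rootP] := iz; exists P => //; move: rootP.
  have [A [B [E E']]] := horner_quadratic_conj (map_poly intr P) p q.
  rewrite /root (map_poly_intr f) E E' => /eqP/quadratic_free[-> ->].
  by rewrite rmorph0 mul0r subr0.
have [|u uE] := @integral_rat_int _ f (2 * p).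
  have -> : f (2 * p) = (f p + f q * s) + (f p - f q * s) by ring.
  exact: integral_add.
have [|N NE] := @integral_rat_int _ f (p ^+ 2 - n%:~R * q ^+ 2).
  have -> : f (p ^+ 2 - n%:~R * q ^+ 2) = (f p + f q * s) * (f p - f q * s).
    by rewrite rmorphB rmorphXn rmorphM rmorphXn /= rmorph_int -hs; ring.
  exact: integral_mul.
have [|v vE] := @squarefree_mul_sqr_int n (u ^+ 2 - 4 * N) (2 * q) hn.
  rewrite rmorphB rmorphXn rmorphM /= -NE -uE; ring.
exists u, v, N; split.
- by rewrite -uE; field.
- by rewrite -vE; field.
apply: (@intr_inj rat).
by rewrite rmorphB rmorphXn !rmorphM /= -NE -uE -vE; ring.
Qed.

End QuadraticField.

(** Squares are 0 or 1 modulo 4, so [u] and [v] are both even, or both are odd and [n] is 1 modulo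
    4. *)
Lemma quadratic_form_parity (n u v N : int) : ~~ (4 %| n)%Z ->
    u ^+ 2 - n * v ^+ 2 = 4 * N ->
  (exists i j : int, u = 2 * i /\ v = 2 * j) \/
  exists m i : int, n = 4 * m + 1 /\ u = 2 * i + v.
Proof.
move=> n4 E.
have [n' [r [rE nE]]] : exists n' r : int,
    (r = 1 \/ r = 2 \/ r = 3) /\ n = 4 * n' + r.
  by exists (n %/ 4)%Z, (n %% 4)%Z; lia.
have [u' [e [eE uE]]] : exists u' e : int, (e = 0 \/ e = 1) /\ u = 2 * u' + e.
  by exists (u %/ 2)%Z, (u %% 2)%Z; lia.
have [v' [h [hE vE]]] : exists u' e : int, (e = 0 \/ e = 1) /\ v = 2 * u' + e.
  by exists (v %/ 2)%Z, (v %% 2)%Z; lia.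
subst n u v; have [h0|h1] := hE; have [e0|e1] := eE; subst h e.
- by left; exists u', v'; lia.
- by exfalso; nia.
- by exfalso; case: rE => [|[]] rE; subst r; nia.
- case: rE => [|[]] rE; subst r; try (exfalso; nia).
  by right; exists n', (u' - v'); lia.
Qed.

(** * Integral basis of the ring of integers *)

Lemma half_sqrt_algint (K : fieldExtType rat) (m : int) (z : K) :
  z ^+ 2 = z + m%:~R -> z \in algint K.
Proof.
move=> zE; apply/algintP; exists ('X^2 - ('X + m%:P)).
  rewrite monicE lead_coefDl ?lead_coefXn // size_polyN size_polyXn.
  by rewrite size_XaddC.
rewrite rmorphB rmorphD /= map_polyXn map_polyX map_polyC /root !hornerE.
by rewrite zE subrr.
Qed.

(** Both shapes of the basis are packed into one triple [w], [t], [m], so that the lattice results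
    apply to either. An integral element is half of some [u + v * s], and the parities of [u] and
    [v] give its coordinates. *)
Lemma ringOfIntegers_quadratic_basis (n : int) (K : fieldExtType rat) (s : K)
    (hs : s ^+ 2 = n%:~R) :
    n <> 1 -> squarefreez n -> <<1; s>>%VS = {:K}%VS ->
  exists (w : ringOfIntegers K) (t m : int),
    [/\ forall z : ringOfIntegers K, exists p q : int, z = p%:~R + q%:~R * w,
        forall p q : int, p%:~R + q%:~R * w = 0 -> p = 0 /\ q = 0,
        w ^+ 2 = t%:~R * w + m%:~R
      & [/\ t = 0, m = n & sqrt_int hs = w] \/
        [/\ t = 1, n = 4 * m + 1 & sqrt_int hs = 2 * w - 1]].
Proof.
move=> hn1 hn hK; pose f : {rmorphism rat -> K} := in_alg K.
have two0 : (2 : K) != 0.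
  by rewrite -(rmorph_nat f 2) fmorph_eq0.
have val_int (k : int) : algint_val (k%:~R : ringOfIntegers K) = k%:~R.
  exact: (rmorph_int (val : {rmorphism ringOfIntegers K -> K})).
have coordP (z : ringOfIntegers K) : exists u v N : int,
    2 * val z = u%:~R + v%:~R * s /\ u ^+ 2 - n * v ^+ 2 = 4 * N.
  have : val z \in <<1; s>>%VS by rewrite hK memvf.
  move=> /Fadjoin_polyP[_ /polyOver1P[P ->] zE].
  have [p [q [E _]]] := horner_quadratic_conj f hs P 0 1.
  rewrite rmorph0 rmorph1 mul1r add0r in E.
  have {}zE : val z = f p + f q * s by rewrite zE -E.
  have := algint_valP z; move/algintP; rewrite -[algint_val z]/(val z) zE.
  move=> /(integral_quadratic hs hn hn1)[u [v [N [-> -> NE]]]].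
  exists u, v, N; split=> //.
  by rewrite !fmorph_div !rmorph_int !rmorph_nat; field.
have n4 : ~~ (4 %| n)%Z.
  by apply/negP => n4; have := hn 2 n4.
have free2 (u v : int) : u%:~R + v%:~R * s = 0 :> K -> u = 0 /\ v = 0.
  move=> E; have [|/eqP + /eqP] := @quadratic_free K f n s hs hn hn1 u%:~R v%:~R.
    by rewrite !rmorph_int.
  by rewrite !intr_eq0 => /eqP-> /eqP->.
case: (EM (exists m : int, n = 4 * m + 1)) => [[m nE]|nN].
- pose w0 : K := (1 + s) / 2.
  have sE : s = 2 * w0 - 1 by rewrite /w0; field.
  have w0E : w0 ^+ 2 = w0 + m%:~R.
    apply: (mulfI two0); apply: (mulfI two0).
    have -> : 2 * (2 * w0 ^+ 2) = s ^+ 2 + 2 * s + 1 by rewrite sE; ring.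
    by rewrite hs nE sE; ring.
  exists (RingOfIntegers (half_sqrt_algint w0E)), 1, m; split.
  + move=> z; have [u [v [N [zE /(quadratic_form_parity n4) uv]]]] := coordP z.
    (* Here [u - v] is even in either parity case, and [2 * i + v + v * s] is twice [i + v * w0]. *)
    have [i uE] : exists i, u = 2 * i + v.
      by case: uv => [[i [j [-> ->]]]|[_ [i [_ ->]]]];
        [exists (i - j); ring|exists i].
    exists i, v; apply: val_inj; rewrite rmorphD rmorphM /= !val_int.
    by apply: (mulfI two0); rewrite zE uE sE; ring.
  + move=> p q /(congr1 val); rewrite rmorphD rmorphM rmorph0 /= !val_int => E.
    have [|] := free2 (2 * p + q) q; last by lia.
    transitivity (2 * (p%:~R + q%:~R * w0)); first by rewrite sE; ring.
    by rewrite E mulr0.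
  + by apply: val_inj; rewrite rmorphXn rmorphD rmorphM /= !val_int mul1r.
  + right; split=> //; apply: val_inj.
    by rewrite rmorphB rmorphM rmorph1 rmorph_nat.
- exists (sqrt_int hs), 0, n; split; last by left.
  + move=> z; have [u [v [N [zE /(quadratic_form_parity n4) uv]]]] := coordP z.
    case: uv => [[i [j [uE vE]]]|[m [_ [nE _]]]]; last by case: nN; exists m.
    exists i, j; apply: val_inj; rewrite rmorphD rmorphM /= !val_int.
    by apply: (mulfI two0); rewrite zE uE vE; ring.
  + move=> p q /(congr1 val); rewrite rmorphD rmorphM rmorph0 /= !val_int.
    exact: free2.
  + by apply: val_inj; rewrite rmorphXn rmorphD rmorphM /= !val_int mul0r add0r.
Qed.

(** * Norms of the two ideals, and principality of their product *)

Lemma absolute_norm_quadratic_span (n : int) (K : fieldExtType rat) (s : K)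
    (hs : s ^+ 2 = n%:~R) (a1 a2 x : int) :
    n <> 1 -> squarefreez n -> <<1; s>>%VS = {:K}%VS ->
    0 < a1 -> coprimez a1 a2 -> a1 * a2 + n = x ^+ 2 ->
  (absolute_norm (ideal_span [set a1%:~R; x%:~R + sqrt_int hs]))%:Z = a1.
Proof.
move=> hn1 hn hK a10 cop hx.
have xE : x ^+ 2 - n = a2 * a1 by rewrite -hx; ring.
have [w [t [m [gen free sqr]]]] := ringOfIntegers_quadratic_basis hs hn1 hn hK.
case=> [[t0 mE ->]|[t1 nE ->]].
  apply: (absolute_norm_span_sqrt gen free sqr) => //.
  by rewrite mE xE dvdz_mull.
have [[k kE]|[k kE]] : (exists k, a1 = 2 * k + 1) \/ exists k, a1 = 2 * k.
  have : a1 = 2 * (a1 %/ 2)%Z + 1 \/ a1 = 2 * (a1 %/ 2)%Z by lia.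
  by case; [left|right]; exists (a1 %/ 2)%Z.
  rewrite kE; apply: (absolute_norm_span_half_odd gen free sqr) => //.
    by rewrite -kE.
  by rewrite -nE xE -kE dvdz_mull.
(* As [a1] is even and [n] is odd, [x] is odd. *)
have [c cE] : exists c, x = 2 * c + 1.
  exists (x %/ 2)%Z; move: xE; rewrite kE nE; set c := (x %/ 2)%Z => xE.
  by have [xc|//] : x = 2 * c \/ x = 2 * c + 1; [lia | rewrite xc in xE; nia].
(* This is [x ^ 2 - n = a1 * a2] divided by 2; since [a2] is odd, it makes [k] even. *)
have E : 2 * (c ^+ 2 + c - m) = k * a2 by subst; nia.
have [b bE] : exists b, k = 2 * b.
  have [e eE] : exists e : int, a2 = 2 * e + 1.
    by apply: (@coprimez_even_odd k); rewrite -kE.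
  by exists (c ^+ 2 + c - m - k * e); subst a2; lia.
have -> : x%:~R + (2 * w - 1) = 2 * (c%:~R + w) by rewrite cE; ring.
have a1E : a1 = 4 * b by rewrite kE bE; ring.
rewrite a1E; apply: (absolute_norm_span_half_even gen free sqr (a2 := a2)) => //.
- by lia.
- by rewrite -a1E.
- by subst k; lia.
Qed.

Theorem theorem1p2 (n : int) (hn1 : n <> 1) (hn : squarefreez n)
    (K : fieldExtType rat) (s : K) (hs : s ^+ 2 = n%:~R)
    (hK : <<1; s>>%VS = {:K}%VS)
    (a1 a2 : int) (ha1 : 0 < a1) (ha2 : 0 < a2) (ha : coprimez a1 a2)
    (x : int) (hx : a1 * a2 + n = x ^+ 2) :
  let alpha : ringOfIntegers K := x%:~R + sqrt_int hs in
  let I1 := ideal_span [set a1%:~R; alpha] in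
  let I2 := ideal_span [set a2%:~R; alpha] in
  [/\ (absolute_norm I1)%:Z = a1, (absolute_norm I2)%:Z = a2
    & principal_ideal (ideal_mul I1 I2)].
Proof.
move=> alpha I1 I2; split.
- exact: absolute_norm_quadratic_span hx.
- apply: (@absolute_norm_quadratic_span n K s hs a2 a1 x) => //.
    by rewrite coprimez_sym.
  by rewrite mulrC.
have /coprimezP[[u v] /= uv] := ha.
(* The cofactor of [alpha] is its conjugate, since [a1 * a2 = x ^ 2 - n] is the norm of [alpha]. *)
exists alpha; apply: (@ideal_mul_comaximal _ u%:~R v%:~R _ _ _
  (x%:~R - sqrt_int hs)).
  by rewrite -!intrM -intrD uv.
have sE : sqrt_int hs ^+ 2 = n%:~R.
  apply: val_inj; rewrite rmorphXn /= hs.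
  exact/esym/(rmorph_int (val : {rmorphism ringOfIntegers K -> K})).
have -> : alpha * (x%:~R - sqrt_int hs) = x%:~R ^+ 2 - sqrt_int hs ^+ 2.
  by rewrite /alpha; ring.
by rewrite sE -rmorphXn /= -hx; ring.
Qed.
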